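(* Let $P$ be a connected minuscule poset, i.e., $P$ is isomorphic to one of: $\mathbf{a}\times\mathbf{b}$ ($a,b\ge1$); the interval $[\varnothing,(b,b)]$ of Young's lattice ($b\ge1$); $P_{a,1,1,a}$ ($a\ge1$); $P(E_6)$; $P(E_7)$. Then $P$ is a distributive lattice, $P\cong J(Q)$ for a (unique) finite poset $Q$, and $P$ is tCDE (i.e., $J(Q)$ is tCDE).
   Context: $\mathbf{a}$ is the chain with $a$ elements; $\times$ is the direct product. Young's lattice: partitions ordered by componentwise $\le$. $P_{a,1,1,a}$ is the poset on $w_1,\ldots,w_a,x_1,y_1,z_1,\ldots,z_a$ with cover relations $w_1\lessdot\cdots\lessdot w_a$, $w_a\lessdot x_1$, $w_a\lessdot y_1$, $x_1\lessdot z_1$, $y_1\lessdot z_1$, $z_1\lessdot\cdots\lessdot z_a$. $P^{\mathrm{shift}}_{\delta_4}$ is the set of boxes $[i,j]$, $1\le i\le j\le4$, ordered componentwise; $P(E_6):=J(P^{\mathrm{shift}}_{\delta_4})$ and $P(E_7):=J(P(E_6))$. $J(Q)$ is the lattice of order ideals of $Q$ under inclusion; $\mathrm{ddeg}$ is the number of covered elements; $\mathrm{uni}$ is uniform. $\mathcal{T}^+_q(I)=1$ iff $q\notin I$ and $q$ minimal in $Q\setminus I$; $\mathcal{T}^-_q(I)=1$ iff $q\in I$ and $q$ maximal in $I$. $\mu$ on $J(Q)$ is toggle-symmetric if $\mathbb{E}(\mu;\mathcal{T}^+_q)=\mathbb{E}(\mu;\mathcal{T}^-_q)$ for all $q\in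 Q$; $J(Q)$ is tCDE if $\mathbb{E}(\mu;\mathrm{ddeg})=\mathbb{E}(\mathrm{uni}_{J(Q)};\mathrm{ddeg})$ for every toggle-symmetric $\mu$. *)

(* Defs.v *)
From HB Require Import structures.
From mathcomp Require Import all_boot all_order all_algebra.
Set Implicit Arguments. Unset Strict Implicit. Unset Printing Implicit Defensive.
Import Order.TTheory GRing.Theory Num.Theory.

Definition is_porder (T : finType) (le : rel T) : Prop :=
  [/\ reflexive le, antisymmetric le & transitive le].

Definition order_iso (T1 T2 : finType) (le1 : rel T1) (le2 : rel T2) : Prop :=
  exists f : T1 -> T2, bijective f /\ forall x y, le1 x y = le2 (f x) (f y).

Definition is_glb (T : finType) (le : rel T) (x y m : T) : Prop :=
  le m x /\ le m y /\ forall z, le z x -> le z y -> le z m.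
Definition is_lub (T : finType) (le : rel T) (x y j : T) : Prop :=
  le x j /\ le y j /\ forall z, le x z -> le y z -> le j z.
Definition distributive_lattice (T : finType) (le : rel T) : Prop :=
  exists (meet join : T -> T -> T),
    (forall x y, is_glb le x y (meet x y)) /\
    (forall x y, is_lub le x y (join x y)) /\
    (forall x y z, meet x (join y z) = join (meet x y) (meet x z)).

Definition is_ideal (Q : finType) (le : rel Q) (I : {set Q}) : bool :=
  [forall x in I, forall y, le y x ==> (y \in I)].
Definition Jt (Q : finType) (le : rel Q) : finType :=
  {I : {set Q} | is_ideal le I}.
Definition Jle (Q : finType) (le : rel Q) : rel (Jt le) :=
  fun I1 I2 => (val I1 \subset val I2).
Arguments Jle {Q} le.

Definition covers (T : finType) (le : rel T) (x y : T) : bool :=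
  [&& le x y, x != y &
      [forall z, ~~ [&& le x z, le z y, z != x & z != y]]].
Definition ddeg (T : finType) (le : rel T) (y : T) : nat :=
  #|[set x | covers le x y]|.

Definition Tplus (Q : finType) (le : rel Q) (q : Q) (I : Jt le) : nat :=
  [&& q \notin val I &
      [forall r, (r \notin val I) && le r q ==> (r == q)]].
Definition Tminus (Q : finType) (le : rel Q) (q : Q) (I : Jt le) : nat :=
  [&& q \in val I & [forall r, (r \in val I) && le q r ==> (r == q)]].

Local Open Scope ring_scope.

Definition expect (R : realFieldType) (T : finType) (mu : T -> R) (f : T -> nat) : R :=
  \sum_(t : T) mu t * (f t)%:R.
Definition is_distribution (R : realFieldType) (T : finType) (mu : T -> R) : Prop :=
  (forall t, 0 <= mu t) /\ \sum_(t : T) mu t = 1.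
Definition uni (R : realFieldType) (T : finType) : T -> R :=
  fun _ => (#|T|%:R)^-1.


Definition toggle_symmetric (R : realFieldType) (Q : finType) (le : rel Q)
  (mu : Jt le -> R) : Prop :=
  forall q : Q, expect mu (Tplus q) = expect mu (Tminus q).

Definition tCDE (Q : finType) (le : rel Q) : Prop :=
  forall (R : realFieldType) (mu : Jt le -> R),
    is_distribution mu -> toggle_symmetric mu ->
    expect mu (ddeg (Jle le)) = expect (@uni R (Jt le)) (ddeg (Jle le)).

Local Close Scope ring_scope.

Definition chprodT (a b : nat) : finType := ('I_a * 'I_b)%type.
Definition chprod_le (a b : nat) : rel (chprodT a b) :=
  fun u v => (u.1 <= v.1)%N && (u.2 <= v.2)%N.

(* Interval [empty, (b,b)] of Young's lattice: partitions (l1 >= l2 >= 0)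
   with l1 <= b, ordered componentwise. *)
Definition youngT (b : nat) : finType :=
  {p : ('I_b.+1 * 'I_b.+1)%type | (p.2 <= p.1)%N}.
Definition young_le (b : nat) : rel (youngT b) :=
  fun u v => ((val u).1 <= (val v).1)%N && ((val u).2 <= (val v).2)%N.

(* P_{a,1,1,a}: inl (inl i) = w_(i+1), inl (inr true) = x_1,
   inl (inr false) = y_1, inr j = z_(j+1); order generated by covers. *)
Definition PaT (a : nat) : finType := (('I_a + bool) + 'I_a)%type.
Definition Pa_cov (a : nat) : rel (PaT a) :=
  fun u v => match u, v with
  | inl (inl i), inl (inl j) => (j == i.+1 :> nat)
  | inl (inl i), inl (inr _) => (i.+1 == a)
  | inl (inr _), inr j => (j == 0 :> nat)
  | inr i, inr j => (j == i.+1 :> nat)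
  | _, _ => false
  end.
Definition Pa_le (a : nat) : rel (PaT a) := connect (@Pa_cov a).

(* Shifted staircase boxes [i,j], 1 <= i <= j <= 4 (0-indexed here). *)
Definition shiftT : finType := {p : ('I_4 * 'I_4)%type | (p.1 <= p.2)%N}.
Definition shift_le : rel shiftT :=
  fun u v => ((val u).1 <= (val v).1)%N && ((val u).2 <= (val v).2)%N.

Definition E6T : finType := Jt shift_le.
Definition E6_le : rel E6T := Jle shift_le.
Definition E7T : finType := Jt E6_le.
Definition E7_le : rel E7T := Jle E6_le.

Definition connected_minuscule (T : finType) (le : rel T) : Prop :=
  (exists a b, [/\ (1 <= a)%N, (1 <= b)%N & order_iso le (@chprod_le a b)]) \/
  (exists b, (1 <= b)%N /\ order_iso le (@young_le b)) \/
  (exists a, (1 <= a)%N /\ order_iso le (@Pa_le a)) \/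
  order_iso le E6_le \/
  order_iso le E7_le.

(* Main.v *)
(** A toggle-symmetric distribution gives expectation [0] to every combination
    of the functions [Tplus q - Tminus q].  As [ddeg I] counts the maximal
    elements of [I], i.e. [ddeg = \sum_q Tminus q], it suffices to exhibit, for
    each [Q] with [J(Q)] minuscule, weights [c] and constants [d <> 0], [k] such
    that [d * ddeg = k + \sum_q c q * (Tplus q - Tminus q)] on [J(Q)]: then [ddeg]
    has expectation [k / d] for every toggle-symmetric distribution, among them
    the uniform one.  The posets [Q] are the disjoint union of two chains, the
    product of a chain with a two-element chain, [P_{a-1,1,1,a-1}], the shifted
    staircase and [P(E_6)].  [Q] is recovered from [J(Q)] as the poset of
    principal ideals, which are the elements with a largest element strictly
    below them. *)
Require Import Defs.
From HB Require Import structures.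
From mathcomp Require Import all_boot all_order all_algebra.
From mathcomp Require Import zify.

Set Implicit Arguments. Unset Strict Implicit. Unset Printing Implicit Defensive.
Import Order.TTheory GRing.Theory Num.Theory.

(** * Order isomorphisms *)

Lemma order_iso_sym (T U : finType) (leT : rel T) (leU : rel U) :
  order_iso leT leU -> order_iso leU leT.
Proof.
move=> [f [[g fK gK] fle]]; exists g; split; first by exists f.
by move=> x y; rewrite fle !gK.
Qed.

Lemma order_iso_trans (T U V : finType) (leT : rel T) (leU : rel U)
    (leV : rel V) :
  order_iso leT leU -> order_iso leU leV -> order_iso leT leV.
Proof.
move=> [f [fB fle]] [g [gB gle]]; exists (g \o f).
by split=> [|x y]; [exact: bij_comp | rewrite fle gle].
Qed.

(** Antisymmetry and reflexivity make an order embedding injective, so the concrete isomorphisms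
    below reduce to comparing the orders and reaching every element. *)
Lemma order_iso_surj (T U : finType) (leT : rel T) (leU : rel U) (f : T -> U) :
    antisymmetric leT -> reflexive leU ->
    (forall x y, leT x y = leU (f x) (f y)) ->
    (forall u, exists t, f t = u) ->
  order_iso leT leU.
Proof.
move=> anti refl fle fsurj; exists f; split=> //.
have finj : injective f.
  by move=> x y fxy; apply: anti; rewrite !fle fxy refl.
have invP u : exists t, f t == u by have [t <-] := fsurj u; exists t.
exists (fun u => xchoose (invP u)) => [t|u]; last exact/eqP/(xchooseP (invP u)).
exact/finj/eqP/(xchooseP (invP (f t))).
Qed.

(** * Order ideals, toggles and certificates for tCDE *)

Section Ideals.
Variables (Q : finType) (le : rel Q).

Lemma idealP (I : {set Q}) :
  reflect (forall x y, x \in I -> le y x -> y \in I) (is_ideal le I).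
Proof.
apply: (iffP forall_inP) => [H x y xI yx|H x xI].
  by have /forallP/(_ y)/implyP := H x xI; apply.
by apply/forallP => y; apply/implyP; apply: H.
Qed.

Lemma Jt_ideal (I : Jt le) x y : x \in val I -> le y x -> y \in val I.
Proof. exact: (idealP _ (valP I)). Qed.

Lemma Jle_porder : is_porder (Jle le).
Proof.
split=> [I|I K IK|I K L]; rewrite /Jle //.
  by apply/val_inj/eqP; rewrite eqEsubset.
exact: subset_trans.
Qed.

Lemma TplusP q (I : Jt le) :
  reflect (q \notin val I /\ forall r, r \notin val I -> le r q -> r = q)
          (Tplus q I != 0).
Proof.
rewrite /Tplus eqb0 negbK; apply: (iffP andP) => -[qI H]; split=> //.
  by move=> r rI rq; apply/eqP; have /forallP/(_ r)/implyP := H; rewrite rI => ->.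
by apply/forallP => r; apply/implyP => /andP[rI rq]; apply/eqP/H.
Qed.

Lemma TminusP q (I : Jt le) :
  reflect (q \in val I /\ forall r, r \in val I -> le q r -> r = q)
          (Tminus q I != 0).
Proof.
rewrite /Tminus eqb0 negbK; apply: (iffP andP) => -[qI H]; split=> //.
  by move=> r rI rq; apply/eqP; have /forallP/(_ r)/implyP := H; rewrite rI => ->.
by apply/forallP => r; apply/implyP => /andP[rI rq]; apply/eqP/H.
Qed.

Lemma TplusE (b : bool) q (I : Jt le) :
    reflect (q \notin val I /\ forall r, r \notin val I -> le r q -> r = q) b ->
  Tplus q I = b.
Proof.
move=> bP; have : (Tplus q I != 0) = b by apply/TplusP/bP.
by move<-; rewrite /Tplus; case: (_ && _).
Qed.

Lemma TminusE (b : bool) q (I : Jt le) :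
    reflect (q \in val I /\ forall r, r \in val I -> le q r -> r = q) b ->
  Tminus q I = b.
Proof.
move=> bP; have : (Tminus q I != 0) = b by apply/TminusP/bP.
by move<-; rewrite /Tminus; case: (_ && _).
Qed.

Hypothesis leP : is_porder le.

(** An element of [D] with the most elements of [Q] below it works: anything strictly above it would
    have a strictly larger down-set. *)
Lemma exists_maximal (D : {set Q}) q0 : q0 \in D ->
  exists2 q, q \in D & forall r, r \in D -> le q r -> r = q.
Proof.
case: leP => refl anti trans q0D.
case: (arg_maxnP (fun q => #|[set y | le y q]|) q0D) => q qD qmax.
exists q => // r rD qr; apply: anti; rewrite qr andbT; apply/negPn/negP => nrq.
have : #|[set y | le y r]| <= #|[set y | le y q]| := qmax r rD.
rewrite leqNgt => /negP; apply; apply/proper_card/properP.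
split; first by apply/subsetP => y; rewrite !inE => /trans; apply.
by exists r; rewrite !inE.
Qed.

Lemma principal_ideal q : is_ideal le [set y | le y q].
Proof.
case: leP => refl anti trans.
by apply/idealP => x y; rewrite !inE => xq yx; apply: trans yx xq.
Qed.

Lemma strict_principal_ideal q : is_ideal le [set y | le y q & y != q].
Proof.
case: leP => refl anti trans.
apply/idealP => x y; rewrite !inE => /andP[xq nxq] yx.
rewrite (trans _ _ _ yx xq); apply: contraNneq nxq => yq.
by apply/eqP/anti; rewrite xq -yq yx.
Qed.

Definition principal q : Jt le := Sub _ (principal_ideal q).

Lemma in_principal q y : (y \in val (principal q)) = le y q.
Proof. by rewrite SubK inE. Qed.

Lemma Jle_principal q r : Jle le (principal q) (principal r) = le q r.
Proof.
case: leP => refl anti trans; rewrite /Jle !SubK.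
apply/subsetP/idP => [/(_ q)|qr y]; rewrite !inE ?refl; first exact.
by move=> yq; apply: trans yq qr.
Qed.

Lemma principal_inj : injective principal.
Proof.
case: leP => refl anti trans q r qr; apply: anti.
by rewrite -!Jle_principal qr Jle_principal refl.
Qed.

(** The right-hand side refers only to the order on ideals, so isomorphisms preserve it. From a
    principal ideal, [I'] drops the generator; conversely, an element of [I] outside [I'] generates
    an ideal inside [I] but not inside [I'], hence all of [I]. *)
Lemma principalP (I : Jt le) :
  (exists q, I = principal q) <->
  (exists2 I' : Jt le, Jle le I' I /\ I' <> I &
     forall K : Jt le, Jle le K I -> K <> I -> Jle le K I').
Proof.
case: leP => refl anti trans; split=> [[q ->]|[I' [I'I neI] Imax]].
  exists (Sub _ (strict_principal_ideal q)) => [|K /subsetP Kq neK].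
    split; first by apply/subsetP => y; rewrite SubK !inE => /andP[].
    by move/(congr1 val)/setP/(_ q); rewrite !SubK !inE refl eqxx.
  apply/subsetP => y yK; rewrite SubK inE.
  have := Kq _ yK; rewrite SubK inE => -> /=.
  apply: contra_notN neK => /eqP yq; apply/val_inj/eqP.
  rewrite eqEsubset; apply/andP; split; first exact/subsetP.
  by apply/subsetP => z; rewrite SubK inE -yq; apply: Jt_ideal.
have /subsetPn[q qI qI'] : ~~ (val I \subset val I').
  by apply: contra_notN neI => II'; apply/val_inj/eqP; rewrite eqEsubset II' andbT.
exists q; apply/eqP/negPn/negP => /eqP neq.
have qsub : Jle le (principal q) I.
  by apply/subsetP => y; rewrite in_principal; apply: Jt_ideal.
have /subsetP/(_ q) := Imax _ qsub (not_eq_sym neq).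
by rewrite in_principal refl (negPf qI') => /(_ isT).
Qed.

Definition toggle_set q (I : {set Q}) := if q \in I then I :\ q else q |: I.

(** The default of [insubd] leaves [I] fixed when the toggled set is not an ideal. *)
Definition toggle q (I : Jt le) : Jt le := insubd I (toggle_set q (val I)).

Lemma toggle_setK q : involutive (toggle_set q).
Proof.
move=> I; rewrite /toggle_set; case qI: (q \in I).
  by rewrite !inE eqxx /= setD1K.
by rewrite !inE eqxx /= setU1K ?qI.
Qed.

Lemma toggleK q : involutive (toggle q).
Proof.
move=> I; rewrite {2}/toggle.
case idI: (is_ideal le (toggle_set q (val I))); last first.
  by rewrite /insubd insubF //= /toggle /insubd insubF.
apply: val_inj; rewrite /toggle !val_insubd idI toggle_setK.
by rewrite (valP I).
Qed.

Lemma toggle_ideal_notin q (I : Jt le) : q \notin val I ->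
  is_ideal le (q |: val I) = (Tplus q I != 0).
Proof.
case: leP => refl anti trans qI; apply/idealP/TplusP => [H|[_ H] x y].
  split=> // r rI rq; have := H q r.
  by rewrite !inE eqxx (negPf rI) orbF => /(_ isT rq)/eqP.
rewrite !inE; case: (eqVneq x q) => [-> _ yq|_ /= xI yx].
  case yI: (y \in _); rewrite ?orbT ?orbF //; apply/eqP/H => //.
  by rewrite yI.
by rewrite (Jt_ideal xI yx) orbT.
Qed.

Lemma toggle_ideal_in q (I : Jt le) : q \in val I ->
  is_ideal le (val I :\ q) = (Tminus q I != 0).
Proof.
case: leP => refl anti trans qI; apply/idealP/TminusP => [H|[_ H] x y].
  split=> // r rI qr; apply/eqP/negPn/negP => nrq; have := H r q.
  by rewrite !inE eqxx nrq rI /= => /(_ isT qr).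
rewrite !inE => /andP[nxq xI] yx; rewrite (Jt_ideal xI yx) andbT.
by apply: contraNneq nxq => yq; apply/eqP/H => //; rewrite -yq.
Qed.

(** If [q] is maximal in [I], toggling removes it and it can be added back. Otherwise the toggle
    either adds [q] or fixes an ideal to which [q] cannot be added, and both sides vanish. *)
Lemma Tplus_toggle q (I : Jt le) : Tplus q (toggle q I) = Tminus q I.
Proof.
suff: (Tplus q (toggle q I) != 0) = (Tminus q I != 0).
  by rewrite /Tplus /Tminus; do 2!case: (_ && _).
case: leP => refl anti trans; have := val_insubd I (toggle_set q (val I)).
rewrite -/(toggle q I) /toggle_set; case: (boolP (q \in val I)) => qI.
  rewrite toggle_ideal_in //; case: (boolP (Tminus q I != 0)) => [_|_] tE.
    apply/TplusP; rewrite tE; split=> [|r]; first by rewrite !inE eqxx.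
    rewrite !inE; case: eqVneq => //= _ rI rq.
    by rewrite (Jt_ideal qI rq) in rI.
  by apply/TplusP; rewrite tE => -[]; rewrite qI.
rewrite toggle_ideal_notin // => tE.
have /negPf-> : ~~ (Tminus q I != 0) by apply/TminusP => -[]; rewrite (negPf qI).
move: tE; case: (boolP (Tplus q I != 0)) => [_|tp] tE; apply/TplusP; rewrite tE => -[].
  by rewrite !inE eqxx.
by move=> *; case/TplusP: tp.
Qed.

(** Reindexing by the involution [toggle q] preserves the constant weights and exchanges the two
    indicators. *)
Lemma uni_toggle_symmetric (R : realFieldType) :
  toggle_symmetric (@uni R (Jt le)).
Proof.
move=> q; rewrite /expect (reindex_inj (inv_inj (toggleK q))) /=.
by apply: eq_bigr => I _; rewrite Tplus_toggle.
Qed.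

(** The ideals covered by [I] are obtained by deleting one maximal element, and distinct maximal
    elements give distinct ideals. *)
Lemma ddeg_Jle (I : Jt le) : ddeg (Jle le) I = \sum_q Tminus q I.
Proof.
case: leP => refl anti trans.
pose rem q : Jt le := insubd I (val I :\ q).
have remE q : Tminus q I != 0 -> val (rem q) = val I :\ q.
  move=> H; have /TminusP[qI _] := H.
  by rewrite val_insubd toggle_ideal_in // H.
transitivity #|[set q | Tminus q I != 0]|; last first.
  rewrite -sum1_card big_mkcond; apply: eq_bigr => q _; rewrite inE /Tminus.
  by case: (_ && _).
rewrite -(card_in_imset (f := rem)); last first.
  move=> q r; rewrite !inE => qm rm /(congr1 val); rewrite !remE // => /setP/(_ q).
  rewrite !inE eqxx /=; have /TminusP[-> _] := qm; rewrite andbT.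
  by move/esym/negbFE/eqP.
apply: eq_card => K; rewrite inE; apply/and3P/imsetP => [[KI nKI /forallP noZ]|].
  have /subsetPn[q0 q0I q0K] : ~~ (val I \subset val K).
    by apply: contraNN nKI => IK; apply/eqP/val_inj/eqP; rewrite eqEsubset IK andbT.
  (* A maximal [q] of the difference is maximal in [I], because [K] is down-closed. Then [K] lies in
     [I] without [q], and the covering relation forces equality. *)
  have [|q] := @exists_maximal (val I :\: val K) q0; first by rewrite inE q0K.
  rewrite inE => /andP[qK qI] qmax.
  have qm : Tminus q I != 0.
    apply/TminusP; split=> // r rI qr; apply: qmax => //.
    by rewrite inE rI andbT; apply: contraNN qK => rK; apply: Jt_ideal rK qr.
  exists q; rewrite ?inE //; apply/eqP.
  have := noZ (rem q); rewrite /Jle (remE _ qm) subD1set /=.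
  have -> : val K \subset val I :\ q by rewrite subsetD1 qK andbT.
  rewrite /= negb_and !negbK => /orP[/eqP->//|/eqP /(congr1 val)].
  by rewrite remE // => /setP/(_ q); rewrite !inE eqxx qI.
move=> [q]; rewrite inE => qm ->; have /TminusP[qI _] := qm.
rewrite /Jle remE // subD1set; split=> //.
  by apply/eqP => /(congr1 val)/setP/(_ q); rewrite remE // !inE eqxx qI.
apply/forallP => Z; apply/and4P => -[/subsetP remZ ZI nZ nZI].
have qZ : q \notin val Z.
  apply: contraNN nZI => qZ; apply/eqP/val_inj/eqP; rewrite eqEsubset ZI.
  apply/subsetP => x xI; case: (eqVneq x q) => [->//|nxq].
  by apply: remZ; rewrite !inE nxq.
case/eqP: nZ; apply/val_inj/eqP; rewrite eqEsubset remE // subsetD1 ZI qZ /=.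
exact/subsetP.
Qed.

Local Open Scope ring_scope.

Lemma tCDE_certificate (d k : int) (c : Q -> int) : d != 0 ->
    (forall I : Jt le, d * \sum_q (Tminus q I)%:R =
       k + \sum_q c q * ((Tplus q I)%:R - (Tminus q I)%:R)) ->
  tCDE le.
Proof.
move=> d0 cert R.
have expE (mu : Jt le -> R) : is_distribution mu -> toggle_symmetric mu ->
    expect mu (ddeg (Jle le)) = k%:~R / d%:~R.
  move=> [_ mu1] muT; apply: (canRL (mulfK _)); first by rewrite intr_eq0.
  have step I : mu I * (ddeg (Jle le) I)%:R * d%:~R = k%:~R * mu I +
     \sum_q (c q)%:~R * (mu I * (Tplus q I)%:R - mu I * (Tminus q I)%:R).
    have := congr1 (fun z : int => mu I * z%:~R) (cert I).
    rewrite ddeg_Jle natr_sum /= rmorphM rmorphD /= !rmorph_sum /= => e.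
    rewrite -mulrA (mulrC _ d%:~R).
    rewrite (_ : mu I * _ = mu I * (d%:~R * \sum_q ((Tminus q I)%:R : int)%:~R));
      last by congr (_ * (_ * _)); apply: eq_bigr => q _; rewrite rmorph_nat.
    rewrite e mulrDr mulrC; congr (_ + _); rewrite mulr_sumr.
    by apply: eq_bigr => q _; rewrite rmorphM rmorphB /= !rmorph_nat mulrCA mulrBr.
  (* Once the sums are exchanged, the term of [q] is a multiple of the difference of the two toggle
     expectations at [q]. *)
  rewrite /expect mulr_suml (eq_bigr _ (fun I _ => step I)) big_split /=.
  rewrite -mulr_sumr mu1 mulr1 exchange_big big1 ?addr0 // => q _.
  by rewrite -mulr_sumr sumrB -!/(expect _ _) muT subrr mulr0.
move=> mu muD muT; rewrite !expE //; last exact: uni_toggle_symmetric.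
(* The empty ideal keeps the uniform weights from being the inverse of zero. *)
have J0 : (0 < #|Jt le|)%N.
  apply/card_gt0P; have id0 : is_ideal le set0 by apply/idealP => x y; rewrite inE.
  by exists (Sub set0 id0).
split=> [I|]; first by rewrite /uni invr_ge0 ler0n.
by rewrite /uni sumr_const -[_ *+ _]mulr_natl divff // pnatr_eq0 -lt0n.
Qed.

End Ideals.

(** * Functoriality of $J$, recovery of $Q$, and distributivity *)

Lemma Jle_order_iso (Q U : finType) (leQ : rel Q) (leU : rel U) :
  order_iso leQ leU -> order_iso (Jle leQ) (Jle leU).
Proof.
move=> [f [[g fK gK] fle]].
have idf (I : Jt leQ) : is_ideal leU (g @^-1: val I).
  by apply/idealP => x y; rewrite !inE => xI yx; apply: Jt_ideal xI _; rewrite fle !gK.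
have idg (I : Jt leU) : is_ideal leQ (f @^-1: val I).
  by apply/idealP => x y; rewrite !inE => xI yx; apply: Jt_ideal xI _; rewrite -fle.
exists (fun I => Sub _ (idf I)); split.
  exists (fun I => Sub _ (idg I)) => I; apply/val_inj/setP => x; rewrite !SubK !inE.
    by rewrite fK.
  by rewrite gK.
move=> I K; rewrite /Jle !SubK.
apply/subsetP/subsetP => [H x|H x xI]; first by rewrite !inE; apply: H.
by have := H (f x); rewrite !inE fK; apply.
Qed.

(** By [principalP] the isomorphism and its inverse preserve principal ideals; following the
    generators gives the map between the base posets. *)
Lemma Jle_order_iso_inv (Q U : finType) (leQ : rel Q) (leU : rel U) :
    is_porder leQ -> is_porder leU ->
  order_iso (Jle leQ) (Jle leU) -> order_iso leQ leU.
Proof.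
move=> Qpo Upo [F [[G FK GK] Fle]].
have Gle I K : Jle leU I K = Jle leQ (G I) (G K) by rewrite Fle !GK.
have prF q : exists r, F (principal Qpo q) == principal Upo r.
  suff [r ->] : exists r, F (principal Qpo q) = principal Upo r by exists r.
  apply/principalP.
  have /principalP[I' [I'q neI'] Imax] : exists r, principal Qpo q = principal Qpo r.
    by exists q.
  exists (F I') => [|K Kq neK].
    by split; [rewrite -Fle | move/(can_inj FK)].
  rewrite Gle FK; apply: Imax; first by rewrite -[principal _ _]FK -Gle.
  by move=> GKE; apply: neK; rewrite -GKE GK.
have prG q : exists r, G (principal Upo q) = principal Qpo r.
  apply/principalP.
  have /principalP[I' [I'q neI'] Imax] : exists r, principal Upo q = principal Upo r.
    by exists q.
  exists (G I') => [|K Kq neK].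
    by split; [rewrite -Gle | move/(can_inj GK)].
  rewrite Fle GK; apply: Imax; first by rewrite -[principal _ _]GK -Fle.
  by move=> FKE; apply: neK; rewrite -FKE FK.
pose f q := xchoose (prF q).
have fE q : F (principal Qpo q) = principal Upo (f q).
  by apply/eqP; apply: (xchooseP (prF q)).
apply: (@order_iso_surj _ _ _ _ f).
- by case: (Qpo).
- by case: (Upo).
- by move=> x y; rewrite -(Jle_principal Qpo) -(Jle_principal Upo) -!fE -Fle.
move=> u; have [r rE] := prG u; exists r.
by apply: (@principal_inj _ _ Upo); rewrite -fE -rE GK.
Qed.

Lemma Jle_distributive_lattice (T Q : finType) (le : rel T) (leQ : rel Q) :
  order_iso le (Jle leQ) -> distributive_lattice le.
Proof.
move=> [F [[G FK GK] Fle]].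
have idI (I K : Jt leQ) : is_ideal leQ (val I :&: val K).
  apply/idealP => x y; rewrite !inE => /andP[xI xK] yx.
  by rewrite (Jt_ideal xI yx) (Jt_ideal xK yx).
have idU (I K : Jt leQ) : is_ideal leQ (val I :|: val K).
  apply/idealP => x y; rewrite !inE => /orP[] xI yx;
  by rewrite (Jt_ideal xI yx) ?orbT.
pose meet x y := G (Sub _ (idI (F x) (F y))).
pose join x y := G (Sub _ (idU (F x) (F y))).
exists meet, join; split=> [x y|]; last split=> [x y|x y z].
- split; last split; rewrite ?Fle ?GK /Jle ?SubK ?subsetIl ?subsetIr //.
  by move=> z; rewrite !Fle GK /Jle SubK subsetI => -> ->.
- split; last split; rewrite ?Fle ?GK /Jle ?SubK ?subsetUl ?subsetUr //.
  by move=> z; rewrite !Fle GK /Jle SubK subUset => -> ->.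
by congr G; apply: val_inj; rewrite !SubK !GK !SubK setIUr.
Qed.

Lemma order_iso_ideals (T Q : finType) (le : rel T) (leQ : rel Q)
    (f : T -> {set Q}) :
    antisymmetric le -> (forall t, is_ideal leQ (f t)) ->
    (forall s t, le s t = (f s \subset f t)) ->
    (forall I : Jt leQ, exists t, val I = f t) ->
  order_iso le (Jle leQ).
Proof.
move=> anti idf fle fsurj.
apply: (@order_iso_surj _ _ _ _ (fun t => Sub (f t) (idf t))) => //.
  by move=> I; rewrite /Jle.
by move=> I; have [t It] := fsurj I; exists t; apply: val_inj; rewrite SubK.
Qed.

(** * Initial segments of chains, and the two-chain posets *)

Lemma initial_segment n (p : pred 'I_n) :
    (forall i j : 'I_n, j <= i -> p i -> p j) ->
  exists2 m, m <= n & forall i, p i = (i < m).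
Proof.
move=> pdown; case: (pickP (predC p)) => [i0 /= npi0|pT]; last first.
  by exists n => // i; rewrite ltn_ord; have /negbFE := pT i.
case: (@arg_minnP _ i0 (predC p) (fun i : 'I_n => i : nat) npi0) => i npi imin.
exists i; first exact: ltnW.
move=> j; case: ltnP => [ji|ij]; first by apply/negPn/negP => /imin; rewrite leqNgt ji.
by apply: contraNF npi; apply: pdown.
Qed.

(** The factor [i < n] accounts for a full chain, whose next position does not exist. *)
Lemma sum_delta n (c : nat -> int) (P : pred nat) i :
  (\sum_(k < n) c k * ((k == i :> nat) && P k)%:R = c i * ((i < n)%N && P i)%:R)%R.
Proof.
case: ltnP => [lt_in|le_ni].
  rewrite (bigD1 (Ordinal lt_in)) //= eqxx big1 ?addr0 // => k.
  by rewrite -val_eqE /= => /negPf->; rewrite mulr0.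
rewrite mulr0 big1 // => k _; case: eqP => [ki|_]; last by rewrite mulr0.
by have := ltn_ord k; rewrite ki ltnNge le_ni.
Qed.

Section TwoChains.
Variables (e : bool) (n m : nat).

(* [e = false] gives the disjoint union of two chains, [e = true] with [n = m]
   gives the product of a chain with the two-element chain. *)
Definition two_chains_le : rel ('I_n + 'I_m)%type := fun u v =>
  match u, v with
  | inl i, inl j => i <= j
  | inr i, inr j => i <= j
  | inl i, inr j => e && (i <= j)
  | inr _, inl _ => false
  end.

Lemma two_chains_porder : is_porder two_chains_le.
Proof.
split.
- by case=> i /=.
- by case=> i [] j //=; rewrite ?andbF // -eqn_leq => /eqP/val_inj->.
- by case=> i [] j [] k //=; lia.
Qed.

Definition two_chains_set (l : nat * nat) : {set 'I_n + 'I_m} :=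
  [set u : 'I_n + 'I_m | match u with inl i => i < l.1 | inr j => j < l.2 end].

Lemma two_chains_ideal l : (e ==> (l.2 <= l.1)) ->
  is_ideal two_chains_le (two_chains_set l).
Proof.
move=> le_l; apply/idealP => -[] i [] j; rewrite !inE //=; move: le_l;
  by case: (e) => //=; lia.
Qed.

Lemma two_chains_subset l l' : l.1 <= n -> l.2 <= m ->
  (two_chains_set l \subset two_chains_set l') = (l.1 <= l'.1) && (l.2 <= l'.2).
Proof.
move=> l1n l2m; apply/subsetP/andP => [sub|[le1 le2] [] i]; last 2 first.
- by rewrite !inE /= => /leq_trans; apply.
- by rewrite !inE /= => /leq_trans; apply.
split; rewrite leqNgt; apply/negP => lt.
  have := sub (inl (Ordinal (leq_trans lt l1n))); rewrite !inE /= lt.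
  by rewrite ltnn => /(_ isT).
have := sub (inr (Ordinal (leq_trans lt l2m))); rewrite !inE /= lt.
by rewrite ltnn => /(_ isT).
Qed.

Lemma two_chains_surj (I : Jt two_chains_le) : (e -> m <= n) ->
  exists l, [/\ l.1 <= n, l.2 <= m, e ==> (l.2 <= l.1) & val I = two_chains_set l].
Proof.
move=> le_mn.
have [|l1 l1n l1P] := @initial_segment n (fun i => inl i \in val I).
  by move=> i j ji iI; apply: Jt_ideal iI _.
have [|l2 l2m l2P] := @initial_segment m (fun i => inr i \in val I).
  by move=> i j ji iI; apply: Jt_ideal iI _.
exists (l1, l2); split=> //=; last first.
  by apply/setP => -[] i; rewrite inE ?l1P ?l2P.
(* If [l1 < l2], then [inr l1] is in [I] while [inl l1], which lies below it and exists because
   [m <= n], is not. *)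
apply/implyP => eT; rewrite leqNgt; apply/negP => lt12.
have lt1m := leq_trans lt12 l2m; have lt1n := leq_trans lt1m (le_mn eT).
have rI : inr (Ordinal lt1m) \in val I by rewrite l2P.
have := @Jt_ideal _ _ I _ (inl (Ordinal lt1n)) rI.
by rewrite l1P /= ltnn eT leqnn => /(_ isT).
Qed.

Section Toggles.
Variables (l : nat * nat) (I : Jt two_chains_le).
Hypotheses (l1n : l.1 <= n) (l2m : l.2 <= m) (lP : e ==> (l.2 <= l.1)).
Hypotheses (le_mn : e -> m <= n) (IE : val I = two_chains_set l).

(** The trailing [&& true] gives all four toggle formulas the shape that [sum_delta] and
    [sum_delta_pred] expect. *)
Lemma Tplus_inl k : Tplus (inl k) I = ((k : nat) == l.1) && true.
Proof.
apply: TplusE; rewrite IE inE andbT; apply: (iffP eqP) => [kE|[kl H]].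
  split=> [|[] r]; rewrite ?inE -?leqNgt ?kE //= => lr rl.
  by congr inl; apply/val_inj => /=; lia.
rewrite -leqNgt in kl; have lt1n := leq_ltn_trans kl (ltn_ord k).
by have := H (inl (Ordinal lt1n)); rewrite inE /= ltnn => /(_ isT kl) [<-].
Qed.

Lemma Tminus_inl k :
  Tminus (inl k) I = ((k : nat).+1 == l.1) && (e ==> (l.2 <= k)).
Proof.
apply: TminusE; rewrite IE inE; apply: (iffP andP) => [[/eqP kE ek]|[kl H]].
  split=> [|[] r]; rewrite ?inE -?kE //= => rl.
    by move=> kr; congr inl; apply/val_inj => /=; lia.
  by case/andP=> eT kr; move: ek; rewrite eT /=; lia.
split.
  rewrite eqn_leq kl leqNgt /=; apply/negP => lt.
  have := H (inl (Ordinal (leq_trans lt l1n))); rewrite inE /= lt.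
  by move=> /(_ isT (leqnSn k)) [/(congr1 val) /=]; lia.
apply/implyP => eT; rewrite leqNgt; apply/negP => lt.
by have := H (inr (Ordinal (leq_trans lt l2m))); rewrite inE /= lt eT leqnn => /(_ isT isT).
Qed.

Lemma Tplus_inr k : Tplus (inr k) I = ((k : nat) == l.2) && (e ==> (k < l.1)).
Proof.
apply: TplusE; rewrite IE inE; apply: (iffP andP) => [[/eqP kE ek]|[kl H]].
  split=> [|[] r]; rewrite ?inE -?leqNgt ?kE //= => lr rl.
    by case/andP: rl => eT; move: ek; rewrite eT /=; lia.
  by congr inr; apply/val_inj => /=; lia.
rewrite -leqNgt in kl; have lt2m := leq_ltn_trans kl (ltn_ord k).
split.
  by have := H (inr (Ordinal lt2m)); rewrite inE /= ltnn => /(_ isT kl) [<-].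
apply/implyP => eT; rewrite ltnNge; apply/negP => lt.
have := H (inl (Ordinal (leq_trans (ltn_ord k) (le_mn eT)))).
by rewrite inE /= -leqNgt lt eT leqnn => /(_ isT isT).
Qed.

Lemma Tminus_inr k : Tminus (inr k) I = ((k : nat).+1 == l.2) && true.
Proof.
apply: TminusE; rewrite IE inE andbT; apply: (iffP eqP) => [kE|[kl H]].
  split=> [|[] r]; rewrite ?inE -?kE //= => rl.
  by move=> kr; congr inr; apply/val_inj => /=; lia.
apply/eqP; rewrite eqn_leq kl leqNgt /=; apply/negP => lt.
have := H (inr (Ordinal (leq_trans lt l2m))); rewrite inE /= lt.
by move=> /(_ isT (leqnSn k)) [/(congr1 val) /=]; lia.
Qed.

End Toggles.

Local Open Scope ring_scope.

(** Removable elements sit one position before the threshold, whence [i.-1]; the factor [0 < i]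
    discards the spurious value at [0.-1 = 0]. *)
Lemma sum_delta_pred N (c : nat -> int) (P : pred nat) i : (i <= N)%N ->
  \sum_(k < N) c k * ((k.+1 == i :> nat) && P k)%:R =
  c i.-1 * ((0 < i)%N && P i.-1)%:R.
Proof.
case: i => [|i] iN; last by under eq_bigr do rewrite eqSS; rewrite sum_delta iN.
by rewrite mulr0 big1 // => k _; rewrite mulr0.
Qed.

(** Each chain has at most one addable and one removable element, so all sums collapse and the
    certificate depends only on the two segment lengths. *)
Lemma tCDE_two_chains (d k : int) (c1 c2 : nat -> int) :
    d != 0 -> (e -> m <= n)%N ->
    (forall l1 l2, (l1 <= n)%N -> (l2 <= m)%N -> (e ==> (l2 <= l1))%N ->
       d * ((0 < l1)%N && (e ==> (l2 <= l1.-1)%N))%:R + d * (0 < l2)%N%:R =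
       k + c1 l1 * (l1 < n)%N%:R
         - c1 l1.-1 * ((0 < l1)%N && (e ==> (l2 <= l1.-1)%N))%:R
         + c2 l2 * ((l2 < m)%N && (e ==> (l2 < l1)%N))%:R
         - c2 l2.-1 * (0 < l2)%N%:R) ->
  tCDE two_chains_le.
Proof.
move=> d0 le_mn cert.
pose c (q : 'I_n + 'I_m) := match q with inl i => c1 i | inr j => c2 j end.
apply: (@tCDE_certificate _ _ two_chains_porder d k c) => // I.
have [[l1 l2] [l1n l2m lP IE]] := two_chains_surj I le_mn.
rewrite !big_sumType /=.
under eq_bigr do rewrite (Tminus_inl l1n l2m lP le_mn IE) -[_%:R]mul1r.
under [X in _ * (_ + X)]eq_bigr do rewrite (Tminus_inr l1n l2m lP le_mn IE) -[_%:R]mul1r.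
under [X in _ + (X + _)]eq_bigr do
  rewrite (Tplus_inl l1n l2m lP le_mn IE) (Tminus_inl l1n l2m lP le_mn IE) mulrBr.
under [X in _ + (_ + X)]eq_bigr do
  rewrite (Tplus_inr l1n l2m lP le_mn IE) (Tminus_inr l1n l2m lP le_mn IE) mulrBr.
rewrite !sumrB.
rewrite (sum_delta_pred (fun=> 1) (fun k => e ==> (l2 <= k)%N) l1n).
rewrite (sum_delta_pred (fun=> 1) xpredT l2m).
rewrite (sum_delta_pred c1 (fun k => e ==> (l2 <= k)%N) l1n).
rewrite (sum_delta_pred c2 xpredT l2m).
rewrite (sum_delta _ c1 xpredT) (sum_delta _ c2 (fun k => e ==> (k < l1)%N)) /=.
by rewrite !mul1r !andbT mulrDr cert // !addrA.
Qed.

End TwoChains.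

Local Open Scope ring_scope.

(** On a single chain of length [n], the weights [j - n] satisfy the certificate with [d = n + 1]
    and [k = n]. The certificates of the two chains are scaled to the common [d = (n + 1)(m + 1)]
    and added. *)
Lemma tCDE_chain_sum n m : tCDE (@two_chains_le false n m).
Proof.
apply: (@tCDE_two_chains _ _ _ (n.+1 * m.+1)%N%:Z
  (n * m.+1 + m * n.+1)%N%:Z (fun j => (j%:Z - n%:Z) * m.+1%:Z)
  (fun j => (j%:Z - m%:Z) * n.+1%:Z)) => // l1 l2 l1n l2m _; rewrite !andbT.
case: l1 l1n => [|l1] l1n; case: l2 l2m => [|l2] l2m /=.
all: case: ltnP => h1; case: ltnP => h2; nia.
Qed.

(* Up to the factor [d = n + 2], affine weights with a common slope are forced:
   two states with [l2 < l1] differ only by increments of [c1] and [c2]. *)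
Lemma tCDE_young n : tCDE (@two_chains_le true n n).
Proof.
apply: (@tCDE_two_chains _ _ _ n.+2%:Z (2 * n)%N%:Z
  (fun j => 2 * (j%:Z - n%:Z)) (fun j => 2 * j%:Z - n%:Z)) => // l1 l2 l1n l2m /=.
case: l1 l1n => [|l1] l1n; case: l2 l2m => [|l2] l2m //=; lia.
Qed.

Local Close Scope ring_scope.

(** The [n.+1] elements of a chain stand for the possible lengths of an initial segment of
    ['I_n]. *)
Lemma chprod_iso n m :
  order_iso (@chprod_le n.+1 m.+1) (Jle (@two_chains_le false n m)).
Proof.
apply: (@order_iso_ideals _ _ _ _
  (fun t : 'I_n.+1 * 'I_m.+1 => two_chains_set n m (t.1 : nat, t.2 : nat))).
- move=> [i j] [i' j'] /=; rewrite /chprod_le /= => H.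
  by congr pair; apply/val_inj => /=; lia.
- by move=> t; apply: two_chains_ideal.
- by move=> s t; rewrite two_chains_subset //= -ltnS ltn_ord.
move=> I; have [//|[l1 l2] [/= l1n l2m _ ->]] := two_chains_surj I.
by exists (inord l1, inord l2); rewrite /= !inordK.
Qed.

Lemma young_iso n : order_iso (@young_le n) (Jle (@two_chains_le true n n)).
Proof.
apply: (@order_iso_ideals _ _ _ _
  (fun t : youngT n => two_chains_set n n ((val t).1 : nat, (val t).2 : nat))).
- move=> s t; rewrite /young_le => H; apply: val_inj.
  case: (val s) (val t) H => [i j] [i' j'] /= H.
  by congr pair; apply/val_inj => /=; lia.
- by move=> t; apply: two_chains_ideal => /=; apply: (valP t).
- by move=> s t; rewrite two_chains_subset //= -ltnS ltn_ord.
move=> I; have [//|[l1 l2] [/= l1n l2n le21 ->]] := two_chains_surj I.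
have tP : (inord l2 : 'I_n.+1) <= (inord l1 : 'I_n.+1) by rewrite !inordK.
by exists (exist _ (inord l1, inord l2) tP); rewrite /= !inordK.
Qed.

(** * The posets $P_{n,1,1,n}$ *)

Section Propeller.
Variable n : nat.

Definition Pa_rank (u : PaT n) : nat :=
  match u with
  | inl (inl i) => i
  | inl (inr _) => n
  | inr j => n.+1 + j
  end.

Lemma Pa_cov_rank u v : Pa_cov u v = (Pa_rank v == (Pa_rank u).+1).
Proof.
by case: u v => [[i|b]|i] [[j|b']|j] //=; try have := ltn_ord i;
  try have := ltn_ord j; lia.
Qed.

Lemma Pa_rank_surj r : r <= n.*2 -> exists u, Pa_rank u = r.
Proof.
move=> r2n; case: (ltngtP r n) => [lt|gt|->]; last by exists (inl (inr true)).
  by exists (inl (inl (Ordinal lt))).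
have lt : r - n.+1 < n by lia.
by exists (inr (Ordinal lt)) => /=; lia.
Qed.

Lemma Pa_rank_bound u : Pa_rank u <= n.*2.
Proof. by case: u => [[i|b]|i] /=; try have := ltn_ord i; lia. Qed.

(** The covers are exactly the pairs of consecutive ranks and no rank up to [n.*2] is empty, so any
    two elements of different ranks are joined by a path of covers. *)
Lemma Pa_leE u v : Pa_le u v = (u == v) || (Pa_rank u < Pa_rank v).
Proof.
apply/idP/orP => [|[/eqP->|]]; last 1 first.
(* Induction on the rank gap, passing through any element one rank below [v]. *)
- move=> /subnKC; move: (_ - _) => d; elim: d v => [|d IHd] v vE.
    by apply: connect1; rewrite Pa_cov_rank -vE addn0.
  have [|w wE] := @Pa_rank_surj (Pa_rank v).-1.
    by have := Pa_rank_bound v; lia.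
  apply: connect_trans (connect1 _); first by apply: (IHd w); lia.
  by rewrite Pa_cov_rank wE; apply/eqP; lia.
- move=> /connectP[p]; elim: p u => [|w p IHp] u /=; first by move=> _ ->; left.
  case/andP; rewrite Pa_cov_rank => /eqP wE wp vE; right.
  by case: (IHp _ wp vE) => [/eqP<-|]; lia.
exact: connect0.
Qed.

Lemma Pa_porder : is_porder (@Pa_le n).
Proof.
split=> [u|u v|v u w]; rewrite !Pa_leE ?eqxx //.
  by case: (eqVneq u v) => //= _; lia.
by case: (eqVneq u v) => [->|_] //= uv; case: (eqVneq v w) => [<-|_] /= vw;
  apply/orP; right=> //; lia.
Qed.

End Propeller.

(* [J(P_{n,1,1,n})]: a rank-threshold ideal for each element of the two chains,
   and one ideal for each of the two incomparable elements of [P_{n+1,1,1,n+1}]. *)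
Definition Pa_set n (t : PaT n.+1) : {set PaT n} :=
  match t with
  | inl (inl i) => [set u | Pa_rank u < i]
  | inl (inr b) => [set u | (Pa_rank u < n) || (u == inl (inr b))]
  | inr j => [set u | Pa_rank u < n.+1 + j]
  end.

Lemma Pa_set_ideal n (t : PaT n.+1) : is_ideal (@Pa_le n) (Pa_set t).
Proof.
apply/idealP => x y; rewrite Pa_leE; case: eqVneq => [->//|_].
case: t => [[i|b]|j]; rewrite !inE /= => H yx; try lia.
by case/orP: H => [|/eqP xE]; [|move: yx; rewrite xE /=]; lia.
Qed.

Lemma Pa_set_subset n (s t : PaT n.+1) :
  Pa_le s t = (Pa_set s \subset Pa_set t).
Proof.
rewrite Pa_leE; apply/orP/subsetP => [[/eqP->//|]|].
  case: s t => [[i|b]|j] [[i'|b']|j'] //=; rewrite ?inE => lt u; rewrite !inE;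
    try have := ltn_ord i; try have := ltn_ord i'; try lia.
  by case/orP => [|/eqP->] /=; lia.
move=> sub; case: (eqVneq s t) => [|nst]; [by left | right].
case: s t sub nst => [[i|b]|j] [[i'|b']|j'] sub nst //=.
- rewrite ltnNge; apply/negP => le_i'i; have lt_i'i : i' < i.
    by rewrite ltn_neqAle le_i'i andbT; apply: contraNneq nst => /val_inj->.
  have lt_i'n : i' < n by have := ltn_ord i; lia.
  by have := sub (inl (inl (Ordinal lt_i'n))); rewrite !inE /= ltnn => /(_ lt_i'i).
- have := ltn_ord i; lia.
- have := sub (inl (inr b)); rewrite !inE eqxx orbT /= => /(_ isT).
  by have := ltn_ord i'; lia.
- have := sub (inl (inr b)); rewrite !inE eqxx orbT /= ltnn => /(_ isT) /eqP[bE].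
  by rewrite bE eqxx in nst.
- lia.
- have := sub (inl (inr true)); rewrite !inE /= => /(_ ltac:(lia)).
  by have := ltn_ord i'; lia.
- have := sub (inl (inr (~~ b'))); rewrite !inE /= ltnn => /(_ ltac:(lia)) /eqP[].
  by case: (b').
rewrite ltnNge; apply/negP => le_j'j; have lt_j'j : j' < j.
  suff : nat_of_ord j' != j by move: le_j'j; lia.
  by apply: contraNneq nst => /val_inj->.
have lt_j'n : j' < n by have := ltn_ord j; lia.
by have := sub (inr (Ordinal lt_j'n)); rewrite !inE /= ltnn => /(_ ltac:(lia)).
Qed.

Lemma Pa_set_surj n (I : Jt (@Pa_le n)) : exists t, val I = Pa_set t.
Proof.
have down x y : x \in val I -> Pa_rank y < Pa_rank x -> y \in val I.
  by move=> xI yx; apply: Jt_ideal xI _; rewrite Pa_leE yx orbT.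
have mid b : inl (inr b) \in val I -> forall i, inl (inl i) \in val I.
  by move=> bI i; apply: down bI _ => /=.
have top b : inl (inr b) \notin val I -> forall j, inr j \in val I = false.
  by move=> bI j; apply: contraNF bI => jI; apply: down jI _ => /=; lia.
(* With both middle elements in [I], only a segment of the upper chain is free; with exactly one,
   [I] is determined; with none, only a segment of the lower chain is free. *)
case xI: (inl (inr true) \in val I); case yI: (inl (inr false) \in val I).
- have [|m mn mP] := @initial_segment n (fun j => inr j \in val I).
    move=> i j; rewrite leq_eqVlt => /orP[/eqP/val_inj->//|ji] iI.
    by apply: down iI _; rewrite /= ltn_add2l.
  exists (inr (Ordinal (mn : m < n.+1))); apply/setP => -[[i|b]|j]; rewrite inE.
  + by rewrite (mid true) //=; have := ltn_ord i; lia.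
  + by case: b; rewrite ?xI ?yI /=; lia.
  + by rewrite mP /= ltn_add2l.
- exists (inl (inr true)); apply/setP => -[[i|b]|j]; rewrite inE.
  + by rewrite (mid true) //=; have := ltn_ord i; lia.
  + by case: b; rewrite ?xI ?yI /= ltnn.
  + by rewrite (top false) ?yI //= orbF; lia.
- exists (inl (inr false)); apply/setP => -[[i|b]|j]; rewrite inE.
  + by rewrite (mid false) //=; have := ltn_ord i; lia.
  + by case: b; rewrite ?xI ?yI /= ltnn.
  + by rewrite (top true) ?xI //= orbF; lia.
have [|m mn mP] := @initial_segment n (fun i => inl (inl i) \in val I).
  move=> i j; rewrite leq_eqVlt => /orP[/eqP/val_inj->//|ji] iI.
  exact: down iI _.
exists (inl (inl (Ordinal (mn : m < n.+1)))); apply/setP => -[[i|b]|j]; rewrite inE.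
- by rewrite mP.
- by case: b; rewrite ?xI ?yI /=; lia.
- by rewrite (top true) ?xI //=; lia.
Qed.

Lemma Pa_iso n : order_iso (@Pa_le n.+1) (Jle (@Pa_le n)).
Proof.
apply: (@order_iso_ideals _ _ _ _ (@Pa_set n)).
- by case: (Pa_porder n.+1).
- exact: Pa_set_ideal.
- exact: Pa_set_subset.
- exact: Pa_set_surj.
Qed.

Section PropellerToggles.
Variables (n : nat) (I : Jt (@Pa_le n)).

Lemma Tplus_Pa_rank r q : val I = [set u | Pa_rank u < r] ->
  Tplus q I = (Pa_rank q == r).
Proof.
move=> IE; apply: TplusE; rewrite IE inE; apply: (iffP eqP) => [qr|[rq H]].
  split=> [|u]; rewrite ?inE -?leqNgt ?qr // => ru.
  by rewrite Pa_leE => /orP[/eqP//|]; rewrite qr ltnNge ru.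
have [|u ur] := @Pa_rank_surj n r; first by have := Pa_rank_bound q; lia.
case: (ltngtP (Pa_rank q) r) rq => // rq _.
have uq : u = q by apply: H; rewrite ?inE ?Pa_leE ur ?ltnn ?rq ?orbT.
by rewrite -uq ur ltnn in rq.
Qed.

Lemma Tminus_Pa_rank r q : r <= n.*2.+1 -> val I = [set u | Pa_rank u < r] ->
  Tminus q I = ((Pa_rank q).+1 == r).
Proof.
move=> r2n IE; apply: TminusE; rewrite IE inE; apply: (iffP eqP) => [qr|[rq H]].
  split=> [|u]; rewrite ?inE -qr // => ru.
  by rewrite Pa_leE => /orP[/eqP//|]; lia.
(* The bound on [r] makes [r.-1] an occupied rank; for positive [r] its elements lie in [I], above
   every [q] of smaller rank. *)
have [|u ur] := @Pa_rank_surj n r.-1; first by lia.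
case: (ltngtP (Pa_rank q).+1 r) rq => // rq _.
have uq : u = q by apply: H; rewrite ?inE ?Pa_leE ur; [|apply/orP; right]; lia.
by rewrite -uq ur in rq; lia.
Qed.

Lemma Tplus_Pa_mid b q : val I = Pa_set (inl (inr b)) ->
  Tplus q I = (q == inl (inr (~~ b))).
Proof.
move=> IE; apply: TplusE; rewrite IE inE; apply: (iffP eqP) => [->|[qn H]].
  split=> [|u] /=; first by rewrite ltnn; case: (b).
  by rewrite inE negb_or Pa_leE /= => /andP[/negPf-> _]; rewrite orbF => /eqP.
apply/esym/H; first by rewrite inE /= ltnn; case: (b).
rewrite Pa_leE; case: q qn {H} => [[i|c]|j]; first by rewrite /= ltn_ord.
  by case: (b) c => [] []; rewrite ?eqxx ?orbT.
by move=> _; apply/orP; right=> /=; lia.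
Qed.

Lemma Tminus_Pa_mid b q : val I = Pa_set (inl (inr b)) ->
  Tminus q I = (q == inl (inr b)).
Proof.
move=> IE; apply: TminusE; rewrite IE inE; apply: (iffP eqP) => [->|[qn H]].
  split=> [|u]; first by rewrite eqxx orbT.
  rewrite inE Pa_leE /= => /orP[un|/eqP//] /orP[/eqP//|]; lia.
case/orP: qn => [qn|/eqP//]; apply/esym/H; first by rewrite inE eqxx orbT.
by rewrite Pa_leE /= qn orbT.
Qed.

End PropellerToggles.

Local Open Scope ring_scope.

(** The last factor counts the elements of rank [r]: one for each rank up to [n.*2], and a second
    one at rank [n]. *)
Lemma sum_Pa_rank n (g : nat -> int) r :
  \sum_(q : PaT n) g (Pa_rank q) * (Pa_rank q == r)%:R =
  g r * ((r <= n.*2)%N%:R + (r == n)%:R).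
Proof.
rewrite !big_sumType /= big_bool /=.
have -> : \sum_(i < n) g i * (i == r :> nat)%:R = g r * (r < n)%N%:R.
  by rewrite -[(r < n)%N]andbT -(sum_delta n g xpredT); under [RHS]eq_bigr do rewrite andbT.
have -> : \sum_(i < n) g (n.+1 + i)%N * ((n.+1 + i)%N == r)%:R
    = g r * (n < r <= n.*2)%N%:R.
  case: (ltnP n r) => [nr|rn] /=; last first.
    by rewrite mulr0 big1 // => i _; rewrite (_ : _ == _ = false) ?mulr0 //; lia.
  have -> : (r <= n.*2)%N = ((r - n.+1 < n)%N && xpredT r) by lia.
  have -> : g r = g (n.+1 + (r - n.+1))%N by congr g; lia.
  rewrite -(sum_delta n (fun k => g (n.+1 + k)%N) (fun=> true)).
  apply: eq_bigr => i _.
  by have -> : ((n.+1 + i)%N == r) = (i == r - n.+1 :> nat)%N && true by lia.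
case: (ltngtP r n) => [lt|gt|->] /=.
- have -> : (r <= n.*2)%N by lia.
  by rewrite !(mulr0, addr0).
- by rewrite !(mulr0, addr0, add0r).
have -> : (n <= n.*2)%N by lia.
by rewrite ?eqxx !(mulr0, addr0, add0r) mulrDr.
Qed.

Lemma tCDE_Pa n : tCDE (@Pa_le n).
Proof.
(* The weights of each rank total -2 up to rank [n] and 0 above. On threshold ideals the weighted
   sum is therefore -2 for the empty ideal, 2 when both middle elements are maximal, and 0
   otherwise. *)
pose g r : int := if (r < n)%N then -2 else if r == n then -1 else 0.
apply: (@tCDE_certificate _ _ (Pa_porder n) 2 2 (fun q => g (Pa_rank q))) => // I.
have rankE r : (r <= n.*2.+1)%N -> val I = [set u | (Pa_rank u < r)%N] ->
    2 * \sum_q (Tminus q I)%:R =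
    2 + \sum_q g (Pa_rank q) * ((Tplus q I)%:R - (Tminus q I)%:R) :> int.
  move=> r2n IE; under eq_bigr do rewrite (Tminus_Pa_rank _ r2n IE) -[_%:R]mul1r.
  under [X in _ = _ + X]eq_bigr do
    rewrite (Tplus_Pa_rank _ IE) (Tminus_Pa_rank _ r2n IE) mulrBr.
  rewrite sumrB sum_Pa_rank.
  case: r r2n {IE} => [|r] r2n.
    rewrite !big1 /g; try by move=> q _; rewrite mulr0.
    by case: (n) => [|n'].
  under eq_bigr do rewrite eqSS.
  under [X in _ - X]eq_bigr do rewrite eqSS.
  rewrite (sum_Pa_rank n (fun=> 1)) sum_Pa_rank /g.
  case: (ltngtP r n) => h; case: (ltngtP r.+1 n) => h' /=; lia.
have [t IE] := Pa_set_surj I; case: t IE => [[i|b]|j] IE.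
- by apply: rankE IE; have := ltn_ord i; lia.
- under eq_bigr do rewrite (Tminus_Pa_mid _ IE).
  under [X in _ = _ + X]eq_bigr do
    rewrite (Tplus_Pa_mid _ IE) (Tminus_Pa_mid _ IE) mulrBr.
  have one (h : PaT n -> int) x : \sum_q h q * (q == x)%:R = h x.
    by rewrite (bigD1 x) //= eqxx mulr1 big1 ?addr0 // => q /negPf->; rewrite mulr0.
  (* The addable and the removable middle element have the same weight, so they cancel. *)
  rewrite sumrB !one /= subrr addr0; under eq_bigr do rewrite -[_%:R]mul1r.
  by rewrite (one (fun=> 1)).
- by apply: rankE IE; have := ltn_ord j; lia.
Qed.

Local Close Scope ring_scope.

(** * The exceptional cases, by computation on bit sequences *)

Lemma order_iso_porder (T U : finType) (leT : rel T) (leU : rel U) :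
  order_iso leT leU -> is_porder leU -> is_porder leT.
Proof.
move=> [f [/bij_inj finj fle]] [refl anti trans].
split=> [x|x y|y x z]; rewrite !fle //; last exact: trans.
by move/anti/finj.
Qed.

Definition ord_rel n (r : rel nat) : rel 'I_n := fun i j => r i j.

Definition antisymmetric_below n (r : rel nat) :=
  all (fun i => all (fun j => r i j && r j i ==> (i == j)) (iota 0 n)) (iota 0 n).

Lemma ord_rel_anti n r : antisymmetric_below n r -> antisymmetric (@ord_rel n r).
Proof.
move=> /allP H i j ij; apply/val_inj/eqP.
have /H/allP/(_ (val j)) : val i \in iota 0 n by rewrite mem_iota /= ltn_ord.
by rewrite mem_iota /= ltn_ord => /(_ isT)/implyP; apply.
Qed.

Lemma forall_ord_iota n (P : pred nat) :
  [forall i : 'I_n, P i] = all P (iota 0 n).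
Proof.
apply/forallP/allP => [H k|H i]; last by apply: H; rewrite mem_iota /= ltn_ord.
by rewrite mem_iota /= => lt_kn; apply: (H (Ordinal lt_kn)).
Qed.

(* The ideals of [ord_rel n r], as characteristic sequences of length [n]; this
   may list further sequences when [r] does not refine the order of [nat]. *)
Fixpoint ideal_bits (r : rel nat) n : seq bitseq :=
  if n is m.+1 then
    flatten [seq rcons s false ::
      (if all (fun k => r k m ==> nth false s k) (iota 0 m)
       then [:: rcons s true] else [::]) | s <- ideal_bits r m]
  else [:: [::]].

Lemma ideal_bits_complete (r : rel nat) (p : pred nat) n :
    (forall k m, k < m < n -> r k m -> p m -> p k) ->
  mkseq p n \in ideal_bits r n.
Proof.
elim: n => [//|n IHn] pdown; rewrite mkseqS /=; apply/flattenP.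
eexists; first apply: map_f.
  by apply: IHn => k m /andP[km mn]; apply: pdown; rewrite km ltnW.
case pn: (p n); last by rewrite inE eqxx.
rewrite ifT ?inE ?eqxx ?orbT //; apply/allP => k; rewrite mem_iota /= => kn.
by rewrite nth_mkseq //; apply/implyP => rkn; apply: pdown rkn pn; rewrite kn /=.
Qed.

Definition bits n (I : {set 'I_n}) : bitseq :=
  mkseq (fun k => [exists i : 'I_n, (i == k :> nat) && (i \in I)]) n.

Lemma nth_bits n (I : {set 'I_n}) (i : 'I_n) : nth false (bits I) i = (i \in I).
Proof.
rewrite nth_mkseq //; apply/existsP/idP => [[j /andP[/eqP/val_inj->]]//|iI].
by exists i; rewrite eqxx.
Qed.

Lemma bits_ideal n r (I : Jt (@ord_rel n r)) : bits (val I) \in ideal_bits r n.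
Proof.
apply: ideal_bits_complete => k m /andP[km mn] rkm.
move=> /existsP[i /andP[/eqP iE iI]]; apply/existsP.
exists (Ordinal (ltn_trans km mn)); rewrite eqxx /=.
by apply: Jt_ideal iI _; rewrite /ord_rel iE.
Qed.

(** Ideals are named by their positions in [L], so that the result is again a relation on [nat] and
    the construction can be iterated. *)
Definition bits_le n (L : seq bitseq) : rel nat := fun i j =>
  all (fun k => nth false (nth [::] L i) k ==> nth false (nth [::] L j) k)
      (iota 0 n).

Definition is_ideal_bits (r : rel nat) n (s : bitseq) :=
  all (fun x => nth false s x ==>
    all (fun y => r y x ==> nth false s y) (iota 0 n)) (iota 0 n).

(** The first check excludes sequences that are not ideals, the second excludes repetitions, and
    [bits_ideal] shows that no ideal is missing. *)
Lemma bits_iso n r (L := ideal_bits r n) :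
    all (is_ideal_bits r n) L -> antisymmetric_below (size L) (bits_le n L) ->
  order_iso (@ord_rel (size L) (bits_le n L)) (Jle (@ord_rel n r)).
Proof.
move=> Lideal Lanti.
apply: (@order_iso_ideals _ _ _ _
  (fun i : 'I_(size L) => [set k : 'I_n | nth false (nth [::] L i) k])).
- exact: ord_rel_anti.
- move=> i; have := allP Lideal _ (mem_nth [::] (ltn_ord i)).
  rewrite /is_ideal_bits -forall_ord_iota => /forallP H.
  apply/idealP => x y; rewrite !inE => xi yx; have := H x; rewrite xi.
  by rewrite -forall_ord_iota => /forallP/(_ y)/implyP; apply.
- move=> i j; rewrite /ord_rel /bits_le -forall_ord_iota.
  by apply/forallP/subsetP => [H k|H k]; [rewrite !inE | have := H k; rewrite !inE];
    [apply/implyP|move/implyP].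
move=> I; have IL := bits_ideal I.
have iL : index (bits (val I)) L < size L by rewrite index_mem.
by exists (Ordinal iL); apply/setP => k; rewrite inE nth_index // nth_bits.
Qed.

Definition bits_plus (r : rel nat) n (s : bitseq) q :=
  ~~ nth false s q &&
  all (fun u => ~~ nth false s u && r u q ==> (u == q)) (iota 0 n).

Definition bits_minus (r : rel nat) n (s : bitseq) q :=
  nth false s q && all (fun u => nth false s u && r q u ==> (u == q)) (iota 0 n).

Lemma Tplus_bits n r (I : Jt (@ord_rel n r)) q :
  Tplus q I = bits_plus r n (bits (val I)) q.
Proof.
rewrite /Tplus /bits_plus -forall_ord_iota nth_bits; congr (nat_of_bool (_ && _)).
by apply: eq_forallb => u; rewrite nth_bits.
Qed.

Lemma Tminus_bits n r (I : Jt (@ord_rel n r)) q :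
  Tminus q I = bits_minus r n (bits (val I)) q.
Proof.
rewrite /Tminus /bits_minus -forall_ord_iota nth_bits; congr (nat_of_bool (_ && _)).
by apply: eq_forallb => u; rewrite nth_bits.
Qed.

Local Open Scope ring_scope.

(** Sums are written with [foldr] so that [vm_compute] can evaluate them. *)
Definition certificate_holds (r : rel nat) n (d k : int) (c : seq int) s : bool :=
  d * foldr (fun q x => (bits_minus r n s q)%:R + x) 0 (iota 0 n) ==
  k + foldr (fun q x => nth 0 c q *
        ((bits_plus r n s q)%:R - (bits_minus r n s q)%:R) + x) 0 (iota 0 n).

Lemma sum_ord_foldr n (F : nat -> int) :
  \sum_(i < n) F i = foldr (fun q x => F q + x) 0 (iota 0 n).
Proof. by rewrite -(big_mkord xpredT) unlock /= /index_iota subn0. Qed.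

Lemma tCDE_bits n r (d k : int) (c : seq int) :
    is_porder (@ord_rel n r) -> d != 0 ->
    all (certificate_holds r n d k c) (ideal_bits r n) ->
  tCDE (@ord_rel n r).
Proof.
move=> po d0 /allP cert.
apply: (@tCDE_certificate _ _ po d k (fun q => nth 0 c q)) => // I.
have /eqP := cert _ (bits_ideal I).
rewrite -!sum_ord_foldr => e; under eq_bigr do rewrite Tminus_bits.
by under [X in _ = _ + X]eq_bigr do rewrite Tplus_bits Tminus_bits.
Qed.

(** Lexicographic order is a linear extension, so [ideal_bits] lists exactly the ideals. *)
Definition shift_boxes : seq (nat * nat) :=
  [:: (0, 0); (0, 1); (0, 2); (0, 3); (1, 1); (1, 2); (1, 3);
      (2, 2); (2, 3); (3, 3)]%N.

(** The names refer to the lattice of ideals: [E6_rel] orders the shifted staircase, and [E7_rel]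
    orders $P(E_6)$, which has 16 elements. *)
Definition E6_rel : rel nat := fun i j =>
  let b := nth (0, 0)%N shift_boxes in
  ((b i).1 <= (b j).1)%N && ((b i).2 <= (b j).2)%N.

Definition E7_rel : rel nat := bits_le 10 (ideal_bits E6_rel 10).

Lemma E6_rel_iso : order_iso (@ord_rel 10 E6_rel) shift_le.
Proof.
have boxP (k : 'I_10) : let b := nth (0, 0)%N shift_boxes k in
    (b.1 <= b.2)%N && (b.2 < 4)%N.
  have /allP : all (fun b => (b.1 <= b.2)%N && (b.2 < 4)%N) shift_boxes by [].
  by apply; apply: mem_nth.
have subP (k : 'I_10) : let b := nth (0, 0)%N shift_boxes k in
    ((inord b.1 : 'I_4) <= (inord b.2 : 'I_4))%N.
  by have /andP[le lt] := boxP k; rewrite /= !inordK // (leq_ltn_trans le lt).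
pose f k : shiftT := exist _ (inord _, inord _) (subP k).
apply: (@order_iso_surj _ _ _ _ f).
- by apply: ord_rel_anti; vm_compute.
- by move=> u; rewrite /shift_le !leqnn.
- move=> i j; rewrite /shift_le /=.
  have /andP[lei lti] := boxP i; have /andP[lej ltj] := boxP j.
  by rewrite !inordK // ?(leq_ltn_trans lei lti) ?(leq_ltn_trans lej ltj).
move=> [[i j] /= leij].
have ijP : (i : nat, j : nat) \in shift_boxes.
  by move: leij; case: i j => [[|[|[|[|]]]] ?] // [[|[|[|[|]]]] ?].
have kP : (index (i : nat, j : nat) shift_boxes < 10)%N by rewrite index_mem.
exists (Ordinal kP); apply: val_inj.
by rewrite /= nth_index //= !inord_val.
Qed.

Lemma E6_iso : order_iso E6_le (Jle (@ord_rel 10 E6_rel)).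
Proof. exact/order_iso_sym/Jle_order_iso/E6_rel_iso. Qed.

Lemma E7_rel_iso : order_iso (@ord_rel 16 E7_rel) (Jle (@ord_rel 10 E6_rel)).
Proof. by apply: (@bits_iso 10 E6_rel); vm_compute. Qed.

Lemma E7_iso : order_iso E7_le (Jle (@ord_rel 16 E7_rel)).
Proof.
apply: Jle_order_iso; apply: order_iso_trans E6_iso _.
exact/order_iso_sym/E7_rel_iso.
Qed.

Lemma E6_rel_porder : is_porder (@ord_rel 10 E6_rel).
Proof.
split=> [i|i j|j i k]; rewrite /ord_rel; first by rewrite /E6_rel !leqnn.
  by move/(@ord_rel_anti 10 E6_rel); apply; vm_compute.
rewrite /E6_rel => /andP[le1 le2] /andP[le1' le2'].
by rewrite (leq_trans le1 le1') (leq_trans le2 le2').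
Qed.

Lemma E7_rel_porder : is_porder (@ord_rel 16 E7_rel).
Proof. by apply: order_iso_porder E7_rel_iso _; apply: Jle_porder. Qed.

(* The weights of [tCDE_E6] and [tCDE_E7] are the unique solutions of the linear
   systems with one equation for each ideal. *)
Lemma tCDE_E6 : tCDE (@ord_rel 10 E6_rel).
Proof.
apply: (@tCDE_bits 10 E6_rel 4 5 [:: -5; -6; -4; -2; -3; -2; 0; -1; 2; 1]).
- exact: E6_rel_porder.
- by [].
- by vm_compute.
Qed.

Lemma tCDE_E7 : tCDE (@ord_rel 16 E7_rel).
Proof.
apply: (@tCDE_bits 16 E7_rel 3 4
  [:: -4; -5; -6; -3; -4; -3; -2; -1; -2; -1; 0; 1; 0; 3; 2; 1]).
- exact: E7_rel_porder.
- by [].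
- by vm_compute.
Qed.

(** * Assembling the five families *)

Theorem theorem6p3 (T : finType) (le : rel T) :
  is_porder le -> connected_minuscule le ->
  distributive_lattice le /\
  exists (Q : finType) (leQ : rel Q),
    [/\ is_porder leQ,
        order_iso le (Jle leQ),
        (forall (Q' : finType) (leQ' : rel Q'),
            is_porder leQ' -> order_iso le (Jle leQ') -> order_iso leQ leQ')
      & tCDE leQ].
Proof.
move=> _ minuscule.
(* Distributivity and uniqueness follow from any isomorphism with some $J(Q)$, so each family only
   has to supply such a tCDE poset. *)
suff [Q [leQ [Qpo Qiso QtCDE]]] : exists (Q : finType) (leQ : rel Q),
    [/\ is_porder leQ, order_iso le (Jle leQ) & tCDE leQ].
  split; first exact: Jle_distributive_lattice Qiso.
  exists Q, leQ; split=> // Q' leQ' Q'po Q'iso.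
  apply: Jle_order_iso_inv => //.
  exact: order_iso_trans (order_iso_sym Qiso) Q'iso.
case: minuscule => [[a [b []]]|].
  case: a b => [//|n] [//|m] _ _ iso.
  exists ('I_n + 'I_m)%type, (@two_chains_le false n m).
  split; [exact: two_chains_porder | | exact: tCDE_chain_sum].
  exact: order_iso_trans iso (chprod_iso n m).
case=> [[n [_ iso]]|].
  exists ('I_n + 'I_n)%type, (@two_chains_le true n n).
  split; [exact: two_chains_porder | | exact: tCDE_young].
  exact: order_iso_trans iso (young_iso n).
case=> [[a []]|].
  (* For [a = 1] the poset [PaT 0] is the two-element antichain. *)
  case: a => [//|n] _ iso.
  exists (PaT n), (@Pa_le n).
  split; [exact: Pa_porder | | exact: tCDE_Pa].
  exact: order_iso_trans iso (Pa_iso n).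
case=> iso.
  exists 'I_10, (@ord_rel 10 E6_rel).
  split; [exact: E6_rel_porder | | exact: tCDE_E6].
  exact: order_iso_trans iso E6_iso.
exists 'I_16, (@ord_rel 16 E7_rel).
split; [exact: E7_rel_porder | | exact: tCDE_E7].
exact: order_iso_trans iso E7_iso.
Qed.
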